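(* Let $m\geq 0$ and $k\geq 1$ be integers, and let $a=(a_{i,j})$ be an $(m+k)\times(m+k)$-matrix with entries in a commutative ring. Let $1\leq i_1<i_2<\cdots<i_k\leq m+k$ be the indices of $k$ fixed rows of $a$ and let $1\leq j_1<j_2<\cdots<j_k\leq m+k$ be the indices of $k$ fixed columns of $a$. Put $R=\{i_1,\dots,i_k\}$ and $C=\{j_1,\dots,j_k\}$. Let $$E=\{j_2,j_4,\dots,j_{2\lfloor k/2\rfloor}\}\subseteq C,\qquad O=\{i_1,i_3,\dots,i_{2\lceil k/2\rceil-1}\}\subseteq R$$ be the set of fixed column indices $j_r$ with even subscript $r$ and the set of fixed row indices $i_r$ with odd subscript $r$, respectively. Then $$\sum_{\substack{S\subseteq E,\ T\subseteq O,\\ |S|=|T|}}\det\left(a_{\overline{T},\,\overline{S}}\right)\cdot\det\left(a_{\overline{R\setminus T},\,\overline{C\setminus S}}\right)=\sum_{\substack{S\subseteq E,\ T\subseteq O,\\ |S|=|T|-1}}\det\left(a_{\overline{T},\,\overline{S\cup\{j_1\}}}\right)\cdot\det\left(a_{\overline{R\setminus T},\,\overline{C\setminus(S\cup\{j_1\})}}\right).$$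
   Context: For $X,Y\subseteq\{1,\dots,m+k\}$, $a_{\overline{X},\overline{Y}}$ denotes the submatrix of $a$ obtained by deleting the rows with index in $X$ and the columns with index in $Y$, keeping the remaining rows and columns in the same order as in $a$. The determinant of the empty ($0\times 0$) matrix is $1$. *)

(* Defs.v *)
From HB Require Import structures.
From mathcomp Require Import all_boot all_order all_algebra.

Set Implicit Arguments.
Unset Strict Implicit.
Unset Printing Implicit Defensive.

Import GRing.Theory.
Local Open Scope ring_scope.

(* [enum_val] lists a set of ordinals in increasing order, so the remaining
   rows and columns keep their order. *)
Definition delmx (A : comPzRingType) (n : nat) (a : 'M[A]_n)
    (X Y : {set 'I_n}) : 'M[A]_(#|~: X|, #|~: Y|) :=
  mxsub (@enum_val _ (mem (~: X))) (@enum_val _ (mem (~: Y))) a.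

(* When #|X| = #|Y|, [conform_mx] merely transports the submatrix along
   #|~: Y| = #|~: X|; its default, the zero matrix, only serves the other,
   meaningless, case. *)
Definition deldet (A : comPzRingType) (n : nat) (a : 'M[A]_n)
    (X Y : {set 'I_n}) : A :=
  \det (conform_mx (0 : 'M[A]_(#|~: X|)) (delmx a X Y)).

Lemma enum_val_ord_lt (n : nat) (B : {set 'I_n}) (p q : 'I_#|B|) :
  (p < q)%N -> (enum_val p < enum_val q)%N.
Proof.
have srt : sorted ltn (map val (enum B)).
  rewrite sorted_map.
  rewrite {1}/enum_mem; apply: sorted_filter; first by move=> x y z; apply: ltn_trans.
  by rewrite -enumT -sorted_map val_enum_ord iota_ltn_sorted.
move=> lt_pq.
have sz (r : 'I_#|B|) : (r < size (enum B))%N by rewrite -cardE.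
have x0 := enum_val p.
rewrite !(enum_val_nth x0) -!(nth_map x0 0%N val) //.
by apply: (sorted_ltn_nth ltn_trans 0%N srt) => //; rewrite inE size_map.
Qed.

Lemma deldetE (A : comPzRingType) (n : nat) (a : 'M[A]_n) (X Y : {set 'I_n})
    (e : #|~: Y| = #|~: X|) :
  deldet a X Y = \det (castmx (erefl, e) (delmx a X Y)).
Proof. by rewrite /deldet -(conform_castmx (erefl, e)) conform_mx_id. Qed.

(* Main.v *)
Require Import Defs.
From HB Require Import structures.
From mathcomp Require Import all_boot all_order all_fingroup all_algebra.
From mathcomp Require Import zify.
Set Implicit Arguments.
Unset Strict Implicit.
Unset Printing Implicit Defensive.
Import GRing.Theory.
Local Open Scope ring_scope.

(* Let c be the submatrix of adj a on rows C and columns R.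
   Jacobi's complementary minor formula turns each product of two minors of a
   in the theorem into the product of two complementary minors of c, up to a
   power of det a and a sign that depends only on R and C.  With
   U = {1} + {even indices} and V = {odd indices}, the difference of the two
   sides then becomes the Laplace-type expansion of the determinant of c with
   its U x V block replaced by zero; since |U| + |V| = k + 1, it vanishes.
   The powers of det a are cancelled generically, by passing to the matrix 'X + a. *)

(** * Increasing enumerations, signs of shuffles, and minors along increasing maps *)

Definition incr n p (f : 'I_p -> 'I_n) := forall x y : 'I_p, (x < y)%N -> (f x < f y)%N.

Lemma incr_inj n p (f : 'I_p -> 'I_n) : incr f -> injective f.
Proof.
move=> incf x y fxy; apply: val_inj.
by case: (ltngtP x y) => // /incf; rewrite fxy ltnn.
Qed.

(** Each map lists the common image as a strictly sorted sequence, and a set has only one such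
    listing. *)
Lemma eq_incr n p (f g : 'I_p -> 'I_n) :
  incr f -> incr g -> f @: [set: 'I_p] = g @: [set: 'I_p] -> f =1 g.
Proof.
move=> incf incg fg.
have srt h : incr h -> sorted (fun u v : 'I_n => (u < v)%N) (map h (enum 'I_p)).
  move=> inch; rewrite sorted_map.
  have := iota_ltn_sorted 0 p; rewrite -val_enum_ord sorted_map.
  by apply: sub_sorted => x y; apply: inch.
have mem h y : (y \in map h (enum 'I_p)) = (y \in h @: [set: 'I_p]).
  apply/mapP/imsetP => [[x _ ->]|[x _ ->]]; exists x => //.
  by rewrite mem_enum.
have eqfg : map f (enum 'I_p) = map g (enum 'I_p).
  apply: (@irr_sorted_eq _ (fun u v : 'I_n => (u < v)%N)); rewrite ?srt //.
  - by move=> ? ? ?; apply: ltn_trans.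
  - by move=> ?; rewrite ltnn.
  - by move=> y; rewrite !mem fg.
by move/eq_in_map: eqfg => eqfg x; apply: eqfg; rewrite mem_enum.
Qed.

(** Induction on [p], removing [0] from the domain and its value [j] from the codomain. This
    contributes the parity of [j] and leaves a smaller shuffle; when [p] is 0 the permutation is
    increasing, hence the identity. *)
Lemma odd_perm_shuffle p q (s : 'S_(p + q)) :
    incr (fun x : 'I_p => s (lshift q x)) ->
    incr (fun y : 'I_q => s (rshift p y)) ->
  odd_perm s = odd (\sum_(x < p) (s (lshift q x) + x)).
Proof.
elim: p s => [|p IHp] s incl incr_.
  rewrite big_ord0 /=; suff -> : s = 1%g by rewrite odd_perm1.
  apply/permP => x; rewrite perm1.
  have -> : x = rshift 0 (Ordinal (ltn_ord x : (x < q)%N)) by apply: val_inj.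
  apply: (@eq_incr q q (fun y : 'I_q => s (rshift 0 y)) (fun y => rshift 0 y)) => //.
  apply/setP => y; transitivity true; [|symmetry]; apply/imsetP.
    exists (s^-1%g y) => //; rewrite (_ : rshift _ _ = s^-1%g y) ?permKV //.
    exact: val_inj.
  by exists y => //; apply: val_inj.
pose j := s ord0.
(* The default [k] of [odflt] is never reached: by injectivity [s] takes the value [j] only at
   [ord0]. *)
pose u (k : 'I_(p + q)) := odflt k (unlift j (s (lift ord0 k))).
have uE k : lift j (u k) = s (lift ord0 k).
  have := neq_lift ord0 k; rewrite -(inj_eq (@perm_inj _ s)) -/j /u.
  by case/unlift_some => k' -> ->.
have u_inj : injective u.
  by move=> x y uxy; apply: (@lift_inj _ ord0); apply: (@perm_inj _ s); rewrite -!uE uxy.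
have sE : s = lift_perm ord0 j (perm u_inj).
  apply/permP => k; case: (unliftP ord0 k) => [k'|] ->.
    by rewrite lift_perm_lift permE uE.
  by rewrite lift_perm_id.
have ltu x y : (s (lift ord0 x) < s (lift ord0 y))%N -> (u x < u y)%N.
  by rewrite -!uE /= /bump; do 2!case: leqP; lia.
have l0 : lshift q (ord0 : 'I_p.+1) = ord0 by apply: val_inj.
have ll (x : 'I_p) : lift ord0 (lshift q x) = lshift q (lift ord0 x) :> 'I_(p + q).+1.
  exact: val_inj.
have lr (y : 'I_q) : lift ord0 (rshift p y) = rshift p.+1 y :> 'I_(p + q).+1.
  exact: val_inj.
rewrite sE odd_lift_perm -sE IHp; first last.
- by move=> x y xy; rewrite !permE; apply: ltu; rewrite !lr; apply: incr_.
- by move=> x y xy; rewrite !permE; apply: ltu; rewrite !ll; apply: incl.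
rewrite big_ord_recl l0 -/j oddD addn0 /=; congr (_ (+) _).
rewrite (eq_bigr (fun x : 'I_p => (u (lshift q x) + x)%N)); last first.
  by move=> x _; rewrite permE.
(* Each remaining left value exceeds [j], so it is one more than the value of [u], and its position
   is also shifted by one; the total change of 2 does not affect parity. *)
rewrite [in RHS](eq_bigr (fun x : 'I_p => ((u (lshift q x) + x) + 2)%N)).
  by rewrite [in RHS]big_split /= big_const_ord iter_addn addn0 oddD oddM addbF.
move=> x _; rewrite -ll -uE.
have : (j < s (lift ord0 (lshift q x)))%N by rewrite ll /j -l0; apply: incl.
by rewrite -uE /= /bump; case: leqP => /=; lia.
Qed.

Lemma ex_incr n p (B : {set 'I_n}) :
  #|B| = p -> exists2 f : 'I_p -> 'I_n, incr f & f @: [set: 'I_p] = B.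
Proof.
move=> <-; exists enum_val => [x y|]; first exact: enum_val_ord_lt.
apply/setP => y; apply/imsetP/idP => [[x _ ->]|By]; first exact: enum_valP.
by exists (enum_rank_in By y) => //; rewrite enum_rankK_in.
Qed.

(** By [eq_incr], any increasing enumeration of the kept indices agrees with [enum_val]. Minors can
    then be handled through convenient enumerations, with no cast left. *)
Lemma deldet_mxsub (A : comPzRingType) n p (a : 'M[A]_n) (X Y : {set 'I_n})
    (f g : 'I_p -> 'I_n) :
    incr f -> incr g -> f @: [set: 'I_p] = ~: X -> g @: [set: 'I_p] = ~: Y ->
  deldet a X Y = \det (mxsub f g a).
Proof.
move=> incf incg imf img.
have cardI (h : 'I_p -> 'I_n) : incr h -> #|h @: [set: 'I_p]| = p.
  by move=> inch; rewrite card_imset ?cardsT ?card_ord //; apply: incr_inj.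
have cX : #|~: X| = p by rewrite -imf cardI.
have cY : #|~: Y| = p by rewrite -img cardI.
case: p / cX f g incf incg imf img cY {cardI} => f g incf incg imf img cY.
rewrite (deldetE a cY); congr (\det _); apply/matrixP => x y.
rewrite castmxE !mxE /= cast_ord_id; congr (a _ _).
  apply: (@eq_incr _ _ enum_val f) => //; first exact: enum_val_ord_lt.
  rewrite imf; apply/setP => z; apply/imsetP/idP => [[t _ ->]|Bz]; first exact: enum_valP.
  by exists (enum_rank_in Bz z) => //; rewrite enum_rankK_in.
apply: (@eq_incr _ _ (fun y => enum_val (cast_ord (esym cY) y)) g) => //.
  by move=> u v uv; apply: enum_val_ord_lt.
rewrite img; apply/setP => z; apply/imsetP/idP => [[t _ ->]|Bz]; first exact: enum_valP.
by exists (cast_ord cY (enum_rank_in Bz z)) => //; rewrite cast_ordK enum_rankK_in.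
Qed.

(** Two injections with disjoint images and [p + q = n] together list every index once, so their
    concatenation is a permutation, in fact a shuffle. *)
Lemma incr_merge n p q (e : (p + q)%N = n) (f : 'I_p -> 'I_n) (f' : 'I_q -> 'I_n) :
    incr f -> incr f' -> (forall x y, f x != f' y) ->
  exists s : 'S_n,
  [/\ forall x, s (cast_ord e (lshift q x)) = f x,
      forall y, s (cast_ord e (rshift p y)) = f' y &
      odd_perm s = odd (\sum_(x < p) (f x + x))].
Proof.
case: n / e f f' => f f' incf incf' ff'.
pose h x := match split x with inl u => f u | inr v => f' v end.
have hl x : h (lshift q x) = f x by rewrite /h (unsplitK (inl x)).
have hr y : h (rshift p y) = f' y by rewrite /h (unsplitK (inr y)).
have inj_h : injective h.
  move=> x y; case: (splitP x) => u xu; case: (splitP y) => v yv.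
  - have -> : x = lshift q u by apply: val_inj.
    have -> : y = lshift q v by apply: val_inj.
    by rewrite !hl => /(incr_inj incf) ->.
  - have -> : x = lshift q u by apply: val_inj.
    have -> : y = rshift p v by apply: val_inj.
    by rewrite hl hr => /eqP; rewrite (negPf (ff' _ _)).
  - have -> : x = rshift p u by apply: val_inj.
    have -> : y = lshift q v by apply: val_inj.
    by rewrite hl hr => /esym /eqP; rewrite (negPf (ff' _ _)).
  - have -> : x = rshift p u by apply: val_inj.
    have -> : y = rshift p v by apply: val_inj.
    by rewrite !hr => /(incr_inj incf') ->.
exists (perm inj_h); split=> [x|y|]; rewrite ?cast_ord_id ?permE ?hl ?hr //.
rewrite odd_perm_shuffle.
- by congr odd; apply: eq_bigr => x _; rewrite permE hl.
- by move=> x y xy; rewrite !permE !hl; apply: incf.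
- by move=> x y xy; rewrite !permE !hr; apply: incf'.
Qed.

(** * Determinants with a zero block and Jacobi's complementary minor formula *)

(** Listing the rows as [f], [f'] and the columns as [g], [g'] makes [M] block lower triangular. The
    sign is the product of two shuffle signs, in which the two sums of positions cancel modulo 2. *)
Lemma det_zero_block_sub (A : comPzRingType) n p q (e : (p + q)%N = n) (M : 'M[A]_n)
    (f g : 'I_p -> 'I_n) (f' g' : 'I_q -> 'I_n) :
    incr f -> incr f' -> (forall x y, f x != f' y) ->
    incr g -> incr g' -> (forall x y, g x != g' y) ->
    (forall x y, M (f x) (g' y) = 0) ->
  \det M = (-1) ^+ (\sum_(x < p) f x + \sum_(x < p) g x)
             * (\det (mxsub f g M) * \det (mxsub f' g' M)).
Proof.
move=> incf incf' ff' incg incg' gg' M0.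
have [s [sl sr ods]] := incr_merge e incf incf' ff'.
have [t [tl tr odt]] := incr_merge e incg incg' gg'.
have -> : (-1) ^+ (\sum_(x < p) f x + \sum_(x < p) g x) = (-1) ^+ s * (-1) ^+ t :> A.
  rewrite ods odt !signr_odd -exprD -[LHS]signr_odd -[RHS]signr_odd.
  by rewrite !big_split !oddD addbACA addbb addbF.
case: n / e M f f' g g' s t sl sr tl tr M0 {incf incf' ff' incg incg' gg' ods odt}.
move=> M f f' g g' s t sl sr tl tr M0.
pose N := row_perm s (col_perm t M).
have detN : \det N = \det (mxsub f g M) * \det (mxsub f' g' M).
  rewrite -(det_lblock _ (dlsubmx N)) -[N in LHS]submxK; congr (\det (block_mx _ _ _ _)).
  - by apply/matrixP => x y; rewrite !mxE -sl -tl !cast_ord_id.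
  - by apply/matrixP => x y; rewrite !mxE -(M0 x y) -sl -tr !cast_ord_id.
  - by apply/matrixP => x y; rewrite !mxE -sr -tr !cast_ord_id.
rewrite -detN /N row_permE col_permE !det_mulmx !det_perm odd_permV.
by rewrite [\det M * _]mulrC mulrACA [X in _ = _ * X]mulrA -!signr_addb !addbb !mul1r.
Qed.

Lemma signr_sqr (A : pzRingType) e : (-1) ^+ e * (-1) ^+ e = 1 :> A.
Proof. by rewrite -exprD addnn -mul2n exprM sqrrN !expr1n. Qed.

Lemma det_zero_block (A : comPzRingType) n (M : 'M[A]_n) (X Y : {set 'I_n}) :
    #|X| = #|Y| -> (forall x y, x \in X -> y \notin Y -> M x y = 0) ->
  \det M = (-1) ^+ (\sum_(x in X) x + \sum_(y in Y) y)
             * (deldet M (~: X) (~: Y) * deldet M X Y).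
Proof.
move=> cXY M0.
have [f incf imf] := ex_incr (erefl #|X|).
have [g incg img] := ex_incr (esym cXY).
have cXY' : #|~: Y| = #|~: X|.
  by apply/eqP; rewrite -(eqn_add2l #|Y|) cardsC -cXY cardsC.
have [f' incf' imf'] := ex_incr (erefl #|~: X|).
have [g' incg' img'] := ex_incr cXY'.
have inX x : f x \in X by rewrite -imf imset_f.
have inY x : g x \in Y by rewrite -img imset_f.
have inX' x : f' x \notin X by rewrite -in_setC -imf' imset_f.
have inY' x : g' x \notin Y by rewrite -in_setC -img' imset_f.
have e : (#|X| + #|~: X|)%N = n by rewrite cardsC card_ord.
have sumE (h : 'I_#|X| -> 'I_n) B : incr h -> h @: [set: 'I__] = B ->
    (\sum_(x in B) x = \sum_x h x)%N.
  move=> inch <-; rewrite big_imset /=; last by move=> x y _ _; apply: incr_inj.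
  by apply: eq_bigl => x; rewrite inE.
rewrite (deldet_mxsub M incf incg) ?setCK // (deldet_mxsub M incf' incg') //.
rewrite (sumE f X) // (sumE g Y) //.
apply: (det_zero_block_sub e) => // [x y|x y|x y]; last by rewrite M0.
  by apply: contraNneq (inX' y) => <-.
by apply: contraNneq (inY' y) => <-.
Qed.

(** The powers of [\det a] on both sides avoid any division and also cover empty [X]. The proof
    computes the determinant of a product [K *m \adj a] in two ways, where [\det K] is the wanted
    minor up to sign. *)
Lemma jacobi_minor (A : comPzRingType) n (a : 'M[A]_n) (X Y : {set 'I_n}) :
    #|X| = #|Y| ->
  \det a ^+ n * deldet a X Y =
  (-1) ^+ (\sum_(x in X) x + \sum_(y in Y) y) * \det a ^+ (n - #|X|).+1
    * deldet (\adj a) (~: Y) (~: X).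
Proof.
move=> cXY; set d := \det a; set e := (_ + _)%N.
have [f incf imf] := ex_incr (erefl #|X|).
have [g incg img] := ex_incr (esym cXY).
have cX' : #|~: X| = (n - #|X|)%N by rewrite cardsCs setCK card_ord.
have [f' incf' imf'] := ex_incr cX'.
have cY' : #|~: Y| = (n - #|X|)%N by rewrite cardsCs setCK card_ord cXY.
have [g' incg' img'] := ex_incr cY'.
have inX x : f x \in X by rewrite -imf imset_f.
have inY x : g x \in Y by rewrite -img imset_f.
have inX' x : f' x \notin X by rewrite -in_setC -imf' imset_f.
(* Every row of K * adj a outside X is a multiple of the corresponding unit
   row, while row f r of K * adj a is row g r of adj a. *)
pose K := \matrix_(x, y) if x \in X then [exists r, (f r == x) && (g r == y)]%:R else a x y.
have KX r y : K (f r) y = (y == g r)%:R.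
  rewrite mxE inX; congr (_%:R); congr nat_of_bool.
  apply/existsP/eqP => [[t /andP[/eqP /(incr_inj incf) -> /eqP ->]]|->] //.
  by exists r; rewrite !eqxx.
have detK : \det K = (-1) ^+ e * deldet a X Y.
  rewrite (@det_zero_block _ _ K X Y) //; last first.
    move=> x y; rewrite -imf => /imsetP[r _ ->] yY; rewrite KX.
    by case: eqP yY => // ->; rewrite inY.
  rewrite (deldet_mxsub _ incf incg) ?setCK //.
  rewrite (_ : mxsub f g K = 1%:M) ?det1 ?mul1r; last first.
    apply/matrixP => r s; rewrite [LHS]mxE KX !mxE.
    by rewrite (inj_eq (incr_inj incg)) eq_sym.
  rewrite !(deldet_mxsub _ incf' incg') //; congr (_ * \det _).
  by apply/matrixP => r s; rewrite !mxE (negPf (inX' r)).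
pose L := K *m \adj a.
have LX' x y : x \notin X -> L x y = d *+ (x == y).
  move=> xX; transitivity ((a *m \adj a) x y); last by rewrite mul_mx_adj !mxE.
  by rewrite !mxE; apply: eq_bigr => z _; rewrite mxE (negPf xX).
have detL : \det L = d ^+ (n - #|X|) * deldet (\adj a) (~: Y) (~: X).
  rewrite (@det_zero_block _ _ L (~: X) (~: X)) //; last first.
    move=> x y; rewrite !inE negbK => xX yX; rewrite LX' //.
    by case: eqP xX => // ->; rewrite yX.
  rewrite exprD signr_sqr mul1r.
  rewrite (deldet_mxsub L incf' incf') ?setCK //.
  rewrite (deldet_mxsub L incf incf) ?setCK // (deldet_mxsub _ incg incf) ?setCK //.
  congr (_ * _).
    rewrite (_ : mxsub _ _ _ = d%:M) ?det_scalar //.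
    by apply/matrixP => r s; rewrite [LHS]mxE LX' // mxE (inj_eq (incr_inj incf')).
  congr (\det _); apply/matrixP => r s; rewrite [LHS]mxE [L _ _]mxE (bigD1 (g r)) //= KX eqxx mul1r.
  by rewrite big1 ?addr0 ?mxE // => y yg; rewrite KX (negPf yg) mul0r.
(* The factor [\det (\adj a)] combines with [\det K] into [\det L]; the factor [\det a] left over
   explains the successor in the exponent. *)
have <- : \det a * \det (\adj a) = d ^+ n by rewrite -det_mulmx mul_mx_adj det_scalar.
have -> : deldet a X Y = (-1) ^+ e * \det K by rewrite detK mulrA signr_sqr mul1r.
rewrite exprS -!mulrA.
rewrite [_ * (_ * \det K)]mulrCA [_ * \det K]mulrC -det_mulmx -/L detL -/d.
by rewrite mulrCA.
Qed.

(** * Minors under change of entries, ring morphisms and negation *)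

Lemma eq_cardsC (T : finType) (X Y : {set T}) : #|X| = #|Y| -> #|~: Y| = #|~: X|.
Proof. by move=> cXY; rewrite [LHS]cardsCs [RHS]cardsCs !setCK cXY. Qed.

Lemma eq_deldet (A : comPzRingType) n (a b : 'M[A]_n) (X Y : {set 'I_n}) :
    #|X| = #|Y| -> (forall x y, x \notin X -> y \notin Y -> a x y = b x y) ->
  deldet a X Y = deldet b X Y.
Proof.
move=> cXY ab.
have [f incf imf] := ex_incr (erefl #|~: X|).
have cY := eq_cardsC cXY.
have [g incg img] := ex_incr cY.
rewrite !(deldet_mxsub _ incf incg) //; congr (\det _).
apply/matrixP => r s; rewrite !mxE ab //.
  by rewrite -in_setC -imf imset_f.
by rewrite -in_setC -img imset_f.
Qed.

Lemma deldet_map (A B : comPzRingType) (h : {rmorphism A -> B}) n (a : 'M[A]_n)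
    (X Y : {set 'I_n}) :
  #|X| = #|Y| -> deldet (map_mx h a) X Y = h (deldet a X Y).
Proof.
move=> cXY.
have [f incf imf] := ex_incr (erefl #|~: X|).
have cY := eq_cardsC cXY.
have [g incg img] := ex_incr cY.
rewrite !(deldet_mxsub _ incf incg) // -det_map_mx; congr (\det _).
by apply/matrixP => r s; rewrite !mxE.
Qed.

Lemma deldetN (A : comPzRingType) n (a : 'M[A]_n) (X Y : {set 'I_n}) :
  #|X| = #|Y| -> deldet (- a) X Y = (-1) ^+ #|~: X| * deldet a X Y.
Proof.
move=> cXY.
have [f incf imf] := ex_incr (erefl #|~: X|).
have cY := eq_cardsC cXY.
have [g incg img] := ex_incr cY.
rewrite !(deldet_mxsub _ incf incg) // -detZ scaleN1r; congr (\det _).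
by apply/matrixP => r s; rewrite !mxE.
Qed.

(** * Determinant of a sum and a vanishing sum of complementary minors *)

(** Block diagonal up to reordering: when [#|X| = #|Y|], its determinant is, up to sign, the minor
    of [a] on [X] and [Y] times the complementary minor of [b]. *)
Definition mixmx (A : comPzRingType) n (a b : 'M[A]_n) (X Y : {set 'I_n}) : 'M[A]_n :=
  \matrix_(x, y) if (x \in X) == (y \in Y) then (if x \in X then a x y else b x y)
                 else 0.

(** In the Leibniz formula, [X] records the rows whose factor is taken from [a]. For a given
    permutation [s], the only [Y] with a nonzero contribution is [s @: X]. *)
Lemma det_add (A : comPzRingType) n (a b : 'M[A]_n) :
  \det (a + b) =
    \sum_(X : {set 'I_n}) \sum_(Y : {set 'I_n} | #|X| == #|Y|) \det (mixmx a b X Y).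
Proof.
under [RHS]eq_bigr do rewrite exchange_big /=.
rewrite [RHS]exchange_big /=; apply: eq_bigr => s _.
have -> : \prod_x (a + b) x (s x) = \prod_x (a x (s x) + b x (s x)).
  by apply: eq_bigr => x _; rewrite mxE.
rewrite bigA_distr big_distrr /=; apply: eq_big => // X _.
rewrite (bigD1 (s @: X)) /=; last by rewrite card_imset //; apply: perm_inj.
rewrite [X in _ = _ + X]big1 ?addr0 => [|Y /andP[_ neqY]].
  congr (_ * _); apply: eq_bigr => x _; rewrite mxE mem_imset ?eqxx //.
  exact: perm_inj.
have [x xXY] : exists x, (x \in X) != (s x \in Y).
  apply/existsP; apply: contraR neqY; rewrite negb_exists => /forallP XY.
  apply/eqP/setP => y; rewrite -(permKV s y) mem_imset; last exact: perm_inj.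
  by have := XY (s^-1%g y); rewrite negbK => /eqP.
by rewrite (bigD1 x) //= mxE (negPf xXY) mul0r mulr0.
Qed.

(** By counting, no permutation can map [U] into the complement of [V], so every Leibniz term meets
    the zero block. *)
Lemma det_large_zero_block (A : comPzRingType) n (M : 'M[A]_n) (U V : {set 'I_n}) :
    (n < #|U| + #|V|)%N -> (forall x y, x \in U -> y \in V -> M x y = 0) ->
  \det M = 0.
Proof.
move=> ltn M0; apply: big1 => s _.
have [x xU sxV] : exists2 x, x \in U & s x \in V.
  apply/exists_inP; apply: contraLR ltn; rewrite negb_exists_in => /forall_inP UV.
  rewrite -leqNgt -[leqRHS]card_ord -(cardsC V) addnC leq_add2l.
  rewrite -(card_imset U (@perm_inj _ s)); apply/subset_leq_card/subsetP => _ /imsetP[x xU ->].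
  by rewrite inE UV.
by rewrite (bigD1 x) //= M0 // mul0r mulr0.
Qed.

(** Expand [\det (b + c)] by [det_add], where [b] is chosen to erase the [U] by [V] block of [c].
    Since [b] is zero outside this block, only [X] inside [U] and [Y] inside [V] survive; there [b]
    equals [- c], whence the sign [(-1) ^+ #|X|]. *)
Lemma sum_compl_minors (A : comPzRingType) n (c : 'M[A]_n) (U V : {set 'I_n}) :
    (n < #|U| + #|V|)%N ->
  \sum_(X : {set 'I_n} | X \subset U)
    \sum_(Y : {set 'I_n} | (Y \subset V) && (#|X| == #|Y|))
      (-1) ^+ (#|X| + (\sum_(x in X) x + \sum_(y in Y) y))
        * (deldet c (~: X) (~: Y) * deldet c X Y) = 0.
Proof.
move=> ltn.
pose b : 'M_n := \matrix_(x, y) if (x \in U) && (y \in V) then - c x y else 0.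
have detbc : \det (b + c) = 0.
  apply: (det_large_zero_block ltn) => x y xU yV.
  by rewrite !mxE xU yV addNr.
rewrite -[RHS]detbc det_add [RHS](bigID (fun X : {set 'I_n} => X \subset U)) /=.
rewrite [X in _ + X]big1 ?addr0 => [|X /subsetPn[x xX xU]]; last first.
  apply: big1 => Y _; apply: big1 => s _; rewrite (bigD1 x) //= !mxE xX (negPf xU) /=.
  by rewrite if_same mul0r mulr0.
apply: eq_bigr => X XU.
rewrite [RHS](bigID (fun Y : {set 'I_n} => Y \subset V)) /=.
rewrite [X in _ + X]big1 ?addr0 => [|Y /andP[_ /subsetPn[y yY yV]]]; last first.
  apply: big1 => s _; rewrite (bigD1 (s^-1%g y)) //= !mxE permKV yY (negPf yV) andbF /=.
  by case: (_ \in X); rewrite /= mul0r mulr0.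
apply: eq_big => [Y|Y /andP[YV /eqP cXY]]; first by rewrite andbC.
have cXY' := esym (eq_cardsC cXY).
rewrite (@det_zero_block _ _ (mixmx _ _ _ _) X Y) //; last first.
  by move=> x y xX yY; rewrite mxE xX (negPf yY).
rewrite (@eq_deldet _ _ (mixmx _ _ _ _) (- c) (~: X)) //; last first.
  move=> x y; rewrite !inE !negbK => xX yY.
  by rewrite !mxE xX yY (subsetP XU) // (subsetP YV).
rewrite (@eq_deldet _ _ (mixmx _ _ _ _) c X) //; last first.
  by move=> x y xX yY; rewrite !mxE (negPf xX) (negPf yY).
by rewrite deldetN // setCK exprD -mulrA mulrCA -[in RHS]mulrA.
Qed.

(** * Passage from rows and columns of the matrix to their subscripts *)

Lemma incr_comp n k p (f : 'I_k -> 'I_n) (h : 'I_p -> 'I_k) :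
  incr f -> incr h -> incr (f \o h).
Proof. by move=> incf inch x y /inch /incf. Qed.

Lemma imsetCD (I J : finType) (f : I -> J) (X : {set I}) :
  injective f -> [set f r | r : I] :\: f @: X = f @: (~: X).
Proof.
move=> injf; apply/setP => y; rewrite inE; apply/andP/imsetP.
  by case=> yX /imsetP[r _ yr]; exists r; rewrite // inE -(mem_imset _ _ injf) -yr.
by case=> r; rewrite inE => rX ->; rewrite mem_imset //; split=> //; apply: imset_f.
Qed.

(** Image and preimage under [f] are inverse bijections between subsets of [U] and subsets of
    [f @: U]. *)
Lemma big_subset_imset (A : nmodType) (I J : finType) (f : I -> J) (U : {set I})
    (P : pred {set J}) (F : {set J} -> A) :
    injective f ->
  \sum_(X : {set J} | (X \subset f @: U) && P X) F X
    = \sum_(X : {set I} | (X \subset U) && P (f @: X)) F (f @: X).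
Proof.
move=> injf; rewrite (reindex_onto (fun X : {set I} => f @: X) (fun X : {set J} => f @^-1: X)) /=.
  apply: eq_bigl => X; have -> : f @^-1: (f @: X) = X.
    by apply/setP => x; rewrite inE mem_imset.
  rewrite eqxx andbT; congr (_ && _); apply/idP/idP; last exact: imsetS.
  by move=> /subsetP sub; apply/subsetP => x xX; rewrite -(mem_imset _ _ injf) sub ?imset_f.
move=> X /andP[/subsetP sub _]; apply/setP => y; apply/imsetP/idP => [[x xX ->]|yX].
  by rewrite inE in xX.
by have /imsetP[x _ yx] := sub y yX; exists x; rewrite // inE -yx.
Qed.

Lemma deldet_imset (A : comPzRingType) n k (b : 'M[A]_n) (f g : 'I_k -> 'I_n)
    (X Y : {set 'I_k}) :
    incr f -> incr g -> #|X| = #|Y| ->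
  deldet b (~: (f @: X)) (~: (g @: Y)) = deldet (mxsub f g b) (~: X) (~: Y).
Proof.
move=> incf incg cXY.
have [u incu imu] := ex_incr (erefl #|X|).
have [v incv imv] := ex_incr (esym cXY).
rewrite (@deldet_mxsub _ _ _ _ (~: X) (~: Y) u v) ?setCK //.
rewrite (@deldet_mxsub _ _ _ _ _ _ (f \o u) (g \o v)) ?setCK //; try exact: incr_comp.
- by congr (\det _); apply/matrixP => r s; rewrite !mxE.
- by rewrite imset_comp imu.
- by rewrite imset_comp imv.
Qed.

(** The adjugate exchanges rows and columns, hence the submatrix [mxsub j i] and the roles of [X]
    for columns and [Y] for rows of [a]. *)
Lemma deldet_imset_adj (A : comPzRingType) n k (a : 'M[A]_n) (i j : 'I_k -> 'I_n)
    (X Y : {set 'I_k}) :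
    incr i -> incr j -> #|X| = #|Y| ->
  \det a ^+ n * deldet a (i @: Y) (j @: X) =
  (-1) ^+ (\sum_(s in Y) i s + \sum_(r in X) j r) * \det a ^+ (n - #|Y|).+1
    * deldet (mxsub j i (\adj a)) (~: X) (~: Y).
Proof.
move=> inci incj cXY.
have injI := incr_inj inci; have injJ := incr_inj incj.
rewrite jacobi_minor ?card_imset // deldet_imset //.
by rewrite !big_imset //= => x y _ _; [apply: injJ | apply: injI].
Qed.

(** Multiplying the formulas for [X], [Y] and for their complements completes both index sums, so
    neither the sign nor the power of [\det a] depends on [X] and [Y]. *)
Lemma deldet_compl_adj (A : comPzRingType) n k (a : 'M[A]_n) (i j : 'I_k -> 'I_n)
    (X Y : {set 'I_k}) :
    incr i -> incr j -> #|X| = #|Y| ->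
  let R := [set i r | r : 'I_k] in
  let C := [set j r | r : 'I_k] in
  let c := mxsub j i (\adj a) in
  \det a ^+ (n + n) * (deldet a (i @: Y) (j @: X) * deldet a (R :\: i @: Y) (C :\: j @: X)) =
  (-1) ^+ (\sum_s i s + \sum_r j r) * \det a ^+ (n + n - k).+2
    * (deldet c (~: X) (~: Y) * deldet c X Y).
Proof.
move=> inci incj cXY /=.
rewrite !imsetCD; try exact: incr_inj.
have cXY' := eq_cardsC cXY.
rewrite exprD mulrACA !deldet_imset_adj // setCK setCK.
set d := \det a; set c := mxsub _ _ _.
rewrite mulrACA; congr (_ * _); rewrite mulrACA -!exprD; congr (_ ^+ _ * _ ^+ _).
  rewrite addnACA; congr (_ + _)%N.
    by rewrite [RHS](bigID (fun s => s \in Y)) /=; congr addn; apply: eq_bigl => s; rewrite inE.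
  by rewrite [RHS](bigID (fun s => s \in X)) /=; congr addn; apply: eq_bigl => s; rewrite inE.
(* This bound makes the truncated subtractions exact when the two exponents are added. *)
have kn : (k <= n)%N by have := leq_card _ (incr_inj inci); rewrite !card_ord.
have := cardsC Y; rewrite card_ord; move: #|Y| #|~: Y| => p q; lia.
Qed.

(** * The signed identity, from regular determinant to arbitrary commutative rings *)

(** After multiplication by [\det a ^+ (n + n)], which can be cancelled, the sum is a common factor
    times the vanishing sum of complementary minors of [mxsub j i (\adj a)]. *)
Lemma signed_sum_deldet_reg (A : comPzRingType) n k (a : 'M[A]_n) (i j : 'I_k -> 'I_n)
    (U V : {set 'I_k}) :
    incr i -> incr j -> (k < #|U| + #|V|)%N -> GRing.lreg (\det a) ->
  let R := [set i r | r : 'I_k] in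
  let C := [set j r | r : 'I_k] in
  \sum_(X : {set 'I_k} | X \subset U)
    \sum_(Y : {set 'I_k} | (Y \subset V) && (#|X| == #|Y|))
      (-1) ^+ (#|X| + (\sum_(x in X) x + \sum_(y in Y) y))
        * (deldet a (i @: Y) (j @: X) * deldet a (R :\: i @: Y) (C :\: j @: X)) = 0.
Proof.
move=> inci incj ltk reg R C.
apply: (@GRing.lregX _ _ (n + n) reg); rewrite mulr0.
set e := (\sum_s i s + \sum_r j r)%N.
rewrite -[RHS](mulr0 ((-1) ^+ e * \det a ^+ (n + n - k).+2)).
rewrite -[X in _ = _ * X](sum_compl_minors (mxsub j i (\adj a)) ltk) !big_distrr /=.
apply: eq_bigr => X _; rewrite !big_distrr /=; apply: eq_bigr => Y /andP[_ /eqP cXY].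
by rewrite mulrCA deldet_compl_adj // mulrCA.
Qed.

Lemma signed_sum_deldet_nz (A : comNzRingType) n k (a : 'M[A]_n) (i j : 'I_k -> 'I_n)
    (U V : {set 'I_k}) :
    incr i -> incr j -> (k < #|U| + #|V|)%N ->
  let R := [set i r | r : 'I_k] in
  let C := [set j r | r : 'I_k] in
  \sum_(X : {set 'I_k} | X \subset U)
    \sum_(Y : {set 'I_k} | (Y \subset V) && (#|X| == #|Y|))
      (-1) ^+ (#|X| + (\sum_(x in X) x + \sum_(y in Y) y))
        * (deldet a (i @: Y) (j @: X) * deldet a (R :\: i @: Y) (C :\: j @: X)) = 0.
Proof.
move=> inci incj ltk R C.
(* char_poly_mx (- a) is 'X + a, whose determinant is monic, hence regular. *)
have /monic_lreg reg := char_poly_monic (- a).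
(* Evaluation at 0 is a ring morphism sending ['X + a] to [a]; it commutes with minors and so
   carries the polynomial identity back to [A]. *)
pose ev0 : {rmorphism {poly A} -> A} := horner_eval 0.
have aE : map_mx ev0 (char_poly_mx (- a)) = a.
  apply/matrixP => x y; rewrite !mxE /= /horner_eval !hornerE.
  by rewrite hornerMn hornerX mul0rn add0r opprK.
have := congr1 ev0 (signed_sum_deldet_reg inci incj ltk reg).
rewrite rmorph0 rmorph_sum => sum0; rewrite -[RHS]sum0; apply: eq_bigr => X _.
rewrite rmorph_sum; apply: eq_bigr => Y /andP[_ /eqP cXY].
rewrite !rmorphM rmorphXn rmorphN1 -!deldet_map ?aE //.
all: have injI := incr_inj inci; have injJ := incr_inj incj.
all: by rewrite ?imsetCD // !card_imset // (eq_cardsC cXY).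
Qed.

(** In the zero ring every equation holds; otherwise [A] is repackaged as a nonzero ring. *)
Lemma signed_sum_deldet (A : comPzRingType) n k (a : 'M[A]_n) (i j : 'I_k -> 'I_n)
    (U V : {set 'I_k}) :
    incr i -> incr j -> (k < #|U| + #|V|)%N ->
  let R := [set i r | r : 'I_k] in
  let C := [set j r | r : 'I_k] in
  \sum_(X : {set 'I_k} | X \subset U)
    \sum_(Y : {set 'I_k} | (Y \subset V) && (#|X| == #|Y|))
      (-1) ^+ (#|X| + (\sum_(x in X) x + \sum_(y in Y) y))
        * (deldet a (i @: Y) (j @: X) * deldet a (R :\: i @: Y) (C :\: j @: X)) = 0.
Proof.
move=> inci incj ltk R C; have [A0|nzA] := eqVneq (1 : A) 0.
  by rewrite -[LHS]mul1r A0 mul0r.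
pose A' : comNzRingType :=
  HB.pack (GRing.ComPzRing.sort A) (GRing.PzSemiRing_isNonZero.Build A nzA).
exact: (@signed_sum_deldet_nz A' n k a i j U V).
Qed.

(** * Signs for alternating subscripts and the final identity *)

(** Each odd [x] contributes the even number [1 + x] and each [y] is even, so only [z], which
    contributes [1 + 0], can change the sign. *)
Lemma sign_alternating (A : comPzRingType) k (z : 'I_k) (X Y : {set 'I_k}) :
    val z = 0%N -> (forall x, x \in X -> x != z -> odd x) ->
    (forall y, y \in Y -> ~~ odd y) ->
  (-1) ^+ (#|X| + (\sum_(x in X) x + \sum_(y in Y) y)) = (-1) ^+ (z \in X) :> A.
Proof.
move=> z0 oddX evenY.
rewrite addnA !exprD -[X in _ * X]prodrXr [X in _ * X]big1 ?mulr1; last first.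
  by move=> y yY; rewrite -signr_odd (negPf (evenY y yY)).
rewrite -sum1_card -exprD -big_split /= -prodrXr.
have sg x : x \in X -> x != z -> (-1) ^+ (1 + x) = 1 :> A.
  by move=> xX xz; rewrite -signr_odd /= oddX.
case: (boolP (z \in X)) => zX; last first.
  by apply: big1 => x xX; apply: sg => //; apply: contraNneq zX => <-.
rewrite (bigD1 z) //= z0 addn0 big1 ?mulr1 // => x /andP[xX xz].
exact: sg.
Qed.

Theorem theorem2 (A : comPzRingType) (m k : nat) (hk : (0 < k)%N)
    (a : 'M[A]_(m + k)) (i j : 'I_k -> 'I_(m + k))
    (hi : forall p q : 'I_k, (p < q)%N -> (i p < i q)%N)
    (hj : forall p q : 'I_k, (p < q)%N -> (j p < j q)%N) :
  let R := [set i r | r : 'I_k] in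
  let C := [set j r | r : 'I_k] in
  let E := [set j r | r : 'I_k & ~~ odd r.+1] in
  let O := [set i r | r : 'I_k & odd r.+1] in
  let j1 := j (Ordinal hk) in
  \sum_(S : {set 'I_(m + k)} | S \subset E)
    \sum_(T : {set 'I_(m + k)} | (T \subset O) && (#|S| == #|T|))
      deldet a T S * deldet a (R :\: T) (C :\: S)
  =
  \sum_(S : {set 'I_(m + k)} | S \subset E)
    \sum_(T : {set 'I_(m + k)} | (T \subset O) && (#|S|.+1 == #|T|))
      deldet a T (j1 |: S) * deldet a (R :\: T) (C :\: (j1 |: S)).
Proof.
move=> R C E O j1; pose z := Ordinal hk.
have injI := incr_inj hi; have injJ := incr_inj hj.
(* Subscripts start at 0 here, so the even subscripts of the statement are the odd [r]. *)
pose E0 := [set r : 'I_k | odd r]; pose O0 := [set r : 'I_k | ~~ odd r].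
have EE : E = j @: E0.
  apply/setP => y; apply/imsetP/imsetP => [[r rE ->]|[r rE ->]]; exists r => //.
    by move: rE; rewrite !inE /= negbK.
  by move: rE; rewrite !inE /= negbK.
have OE : O = i @: O0.
  by apply/setP => y; apply/imsetP/imsetP => [[r rE ->]|[r rE ->]]; exists r => //;
    move: rE; rewrite !inE /=.
have zE0 : z \notin E0 by rewrite inE.
have outer (F : {set 'I_(m + k)} -> A) :
    \sum_(S : {set 'I_(m + k)} | S \subset E) F S
      = \sum_(X : {set 'I_k} | X \subset E0) F (j @: X).
  have := big_subset_imset E0 xpredT F injJ; rewrite -EE.
  by under eq_bigl do rewrite andbT; under [RHS]eq_bigl do rewrite andbT.
rewrite !outer OE; pose P (X Y : {set 'I_k}) := deldet a (i @: Y) (j @: X)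
  * deldet a (R :\: i @: Y) (C :\: j @: X).
transitivity (\sum_(X : {set 'I_k} | X \subset E0)
    \sum_(Y : {set 'I_k} | (Y \subset O0) && (#|X| == #|Y|)) P X Y).
  apply: eq_bigr => X _; rewrite (big_subset_imset _ (fun T => #|_| == #|T|)) //.
  by apply: eq_bigl => Y; rewrite !card_imset.
(* Since [z] is not in [E0], adjoining [j1] to [S] amounts to adjoining [z] to [X], and the
   condition [#|S|.+1 == #|T|] becomes equality of cardinals. *)
transitivity (\sum_(X : {set 'I_k} | X \subset E0)
    \sum_(Y : {set 'I_k} | (Y \subset O0) && (#|z |: X| == #|Y|)) P (z |: X) Y); last first.
  apply: eq_bigr => X XE; rewrite (big_subset_imset _ (fun T => _.+1 == #|T|)) //.
  apply: eq_big => [Y|Y _]; last by rewrite /P imsetU1.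
  by rewrite !card_imset // cardsU1 (contra (subsetP XE z)).
(* [E0] and [O0] together already account for all [k] subscripts; the extra element [z] gives the
   strict inequality. *)
have cardU : (k < #|z |: E0| + #|O0|)%N.
  rewrite cardsU1 zE0 -addnA add1n ltnS -[leqLHS]card_ord -(cardsC E0) leq_add2l.
  by apply/subset_leq_card/subsetP => r; rewrite !inE.
have /= := signed_sum_deldet a hi hj cardU; rewrite -/R -/C.
(* The terms with [z \notin X] carry sign [+1] and give the left side; those with [z \in X] carry
   sign [-1] and give the right side. *)
rewrite (bigID (fun X : {set 'I_k} => z \in X)) /= => /addr0_eq sumP.
have sgn (X Y : {set 'I_k}) : X \subset z |: E0 -> Y \subset O0 ->
    (-1) ^+ (#|X| + (\sum_(x in X) x + \sum_(y in Y) y)) = (-1) ^+ (z \in X) :> A.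
  move=> /subsetP XU /subsetP YO; apply: sign_alternating => // [x /XU|y /YO].
    by rewrite !inE => /orP[->|].
  by rewrite inE.
transitivity (\sum_(X : {set 'I_k} | (X \subset z |: E0) && (z \notin X))
    \sum_(Y : {set 'I_k} | (Y \subset O0) && (#|X| == #|Y|)) P X Y).
  apply: eq_bigl => X; apply/idP/andP => [XE|[/subsetP XU zX]].
    by rewrite (subset_trans XE (subsetUr _ _)) (contra (subsetP XE z)).
  apply/subsetP => x xX; have := XU x xX; rewrite in_setU1 => /predU1P[xz|//].
  by rewrite -xz xX in zX.
transitivity (\sum_(X : {set 'I_k} | (X \subset z |: E0) && (z \in X))
    \sum_(Y : {set 'I_k} | (Y \subset O0) && (#|X| == #|Y|)) P X Y); last first.
  (* Adjoining [z] is a bijection from the subsets of [E0] to the subsets of [z |: E0] that contain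
     [z]. *)
  rewrite (reindex_onto (fun X => z |: X) (fun X => X :\ z)) => [|X /andP[_ zX]]; last first.
    by rewrite setD1K.
  apply: eq_bigl => X; rewrite setU11 andbT; apply/andP/idP => [[/subsetP XU /eqP XE]|XE].
    apply/subsetP => x; rewrite -XE => /setD1P[xz /XU].
    by rewrite in_setU1 (negPf xz).
  by rewrite setUS // setU1K // (contra (subsetP XE z)).
transitivity (\sum_(X : {set 'I_k} | (X \subset z |: E0) && (z \notin X))
    \sum_(Y : {set 'I_k} | (Y \subset O0) && (#|X| == #|Y|))
      (-1) ^+ (#|X| + (\sum_(x in X) x + \sum_(y in Y) y)) * P X Y).
  apply: eq_bigr => X /andP[XU zX]; apply: eq_bigr => Y /andP[YO _].
  by rewrite sgn // (negPf zX) mul1r.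
rewrite -sumP -sumrN; apply: eq_bigr => X /andP[XU zX]; rewrite -sumrN.
by apply: eq_bigr => Y /andP[YO _]; rewrite sgn // zX mulN1r opprK.
Qed.
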